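(* Let $(K,d)$ be a cochain complex with both a filtration $K=K_0\supset K_1\supset\cdots\supset K_S\supset K_{S+1}=0$ satisfying $dK_j\subset K_j$ and a compatible grading $K=K^0\oplus\cdots\oplus K^n$ satisfying $dK^k\subset K^{k+1}$ and $K^k\subset K_k$. Then $(K,d)$ admits a spectral sequence associated to the filtration, whose page $r$ is identified, via $[x]_r\mapsto[(x)_p]$, with the quotients $Z_r^{p,\bullet}/B_r^{p,\bullet}$, and whose differentials, for $r=1,\dots,S$, have the expression $$\partial_r:Z_r^{p,\bullet}/B_r^{p,\bullet}\to Z_r^{p+r,\bullet}/B_r^{p+r,\bullet},\qquad \partial_r([x])=\Big[d_{(r)}x-\sum_{i=1}^{r-1}d_{(i)}z_{p+r-i}\Big],$$ where $x\in Z_r^{p,\bullet}$ and $z_{p+j}\in K_{(p+j)}$, $1\le j\le r-1$, are any elements satisfying $d_{(m)}x=\sum_{i=0}^{m-1}d_{(i)}z_{p+m-i}$ for all $1\le m\le r-1$.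
   Context: $K$ is a vector space with a linear map $d$, $d^2=0$. The filtration is compatible with the grading: $K_j=\bigoplus_k K^k_j$, $K^k_j=K_j\cap K^k$. Choose complements $K^k_j=K^k_{(j)}\oplus K^k_{j+1}$, put $K_{(j)}=\bigoplus_kK^k_{(j)}$ (with $K_{(j)}=0$ for $j\notin\{0,\dots,S\}$), and decompose $d=d_{(0)}+\cdots+d_{(S)}$ with $d_{(i)}K^k_{(j)}\subset K^{k+1}_{(j+i)}$. The bidegree $(p,q)$ part is $K^{p+q}_{(p)}$, and $\bullet$ stands for the second index. $(x)_p$ denotes the component of $x$ in $K_{(p)}$. The spectral sequence of the filtration has pages $E_r^{p,\bullet}=\mathcal Z_r^{p,\bullet}/\mathcal B_r^{p,\bullet}$, with $\mathcal Z_r^{p,\bullet}=\{c\in K_p: dc\in K_{p+r}\}$ and $\mathcal B_r^{p,\bullet}=\mathcal Z_{r-1}^{p+1,\bullet}+d\mathcal Z_{r-1}^{p-(r-1),\bullet}$ for $r\ge1$ (with $K_q=K$ for $q\le0$ and $K_q=0$ for $q>S$). The class of $x\in\mathcal Z_r^{p,\bullet}$ is $[x]_r$, and the differential is $[x]_r\mapsto[dx]_r$. For $r\ge1$, the subspaces $Z_r^{p,\bullet},B_r^{p,\bullet}\subset K_{(p)}$ are defined by: - $x\in Z_r^{p,\bullet}$ iff $d_{(0)}x=0$ and there exist $z_{p+j}\in K_{(p+j)}$, $1\le j\le r-1$, with $d_{(m)}x=\sum_{i=0}^{m-1}d_{(i)}z_{p+m-i}$ for all $1\le m\le r-1$; -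 $x\in B_r^{p,\bullet}$ iff there exist $c_{p-k}\in K_{(p-k)}$, $0\le k\le r-1$, with $x=\sum_{k=0}^{r-1}d_{(k)}c_{p-k}$ and $0=\sum_{k=l}^{r-1}d_{(k-l)}c_{p-k}$ for $1\le l\le r-1$. *)

(* Defs.v *)
From HB Require Import structures.
From mathcomp Require Import all_boot all_order all_algebra.
From mathcomp Require Import generic_quotient ring_quotient.
From mathcomp Require Import boolp.
From mathcomp Require Import zify.

Set Implicit Arguments.
Unset Strict Implicit.
Unset Printing Implicit Defensive.

Import Order.TTheory GRing.Theory Num.Theory.
Local Open Scope ring_scope.

Section LinearAlgebra.
Variables (F : fieldType) (V : lmodType F).

Definition is_direct_sum (I : finType) (A : I -> {pred V}) (B : {pred V}) :=
  (forall u : I -> V, (forall i, u i \in A i) -> \sum_i u i \in B) /\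
  (forall x, x \in B -> exists! u : {ffun I -> V},
     (forall i, u i \in A i) /\ x = \sum_i u i).

Definition is_direct_sum2 (A1 A2 B : {pred V}) :=
  (forall a b, a \in A1 -> b \in A2 -> a + b \in B) /\
  (forall x, x \in B -> exists! ab : V * V,
     [/\ ab.1 \in A1, ab.2 \in A2 & x = ab.1 + ab.2]).

End LinearAlgebra.

Section LinearQuotient.
Variables (F : fieldType) (V : lmodType F) (W : submodClosed V).

Lemma submod_zmod_closed : zmod_closed W.
Proof.
by split=> [|x y Wx Wy]; rewrite ?rpred0 // -scaleN1r rpredD ?rpredZ.
Qed.

Definition zmod_of_submod : {pred V} := W.
HB.instance Definition _ :=
  GRing.isZmodClosed.Build V zmod_of_submod submod_zmod_closed.

Definition lquot := Quotient.quot zmod_of_submod.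
HB.instance Definition _ := GRing.Zmodule.on lquot.
HB.instance Definition _ := EqQuotient.on lquot.

Definition lquot_pi (x : V) : lquot := (\pi_(Quotient.quot zmod_of_submod) x)%qT.

Lemma lquot_piP x y : lquot_pi x = lquot_pi y <-> x - y \in W.
Proof.
rewrite -[_ \in W]/(_ \in zmod_of_submod) Quotient.idealrBE.
by split=> [/eqP|/eqP].
Qed.

Lemma lquot_piD x y : lquot_pi (x + y) = lquot_pi x + lquot_pi y.
Proof. exact: Quotient.pi_add. Qed.

Lemma lquot_pi_repr (u : lquot) : lquot_pi (repr u) = u.
Proof. exact: reprK. Qed.

Definition lquot_scale (a : F) (u : lquot) : lquot := lquot_pi (a *: repr u).

Lemma lquot_scaleE a x : lquot_scale a (lquot_pi x) = lquot_pi (a *: x).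
Proof.
by apply/lquot_piP; rewrite -scalerBr rpredZ //; apply/lquot_piP/lquot_pi_repr.
Qed.

Fact lquot_scaleA a b u : lquot_scale a (lquot_scale b u) = lquot_scale (a * b) u.
Proof. by rewrite -[u]lquot_pi_repr !lquot_scaleE scalerA. Qed.
Fact lquot_scale1 : left_id 1 lquot_scale.
Proof. by move=> u; rewrite -[u]lquot_pi_repr !lquot_scaleE scale1r. Qed.
Fact lquot_scaleDr : right_distributive lquot_scale +%R.
Proof.
move=> a u v; rewrite -[u]lquot_pi_repr -[v]lquot_pi_repr.
by rewrite -lquot_piD !lquot_scaleE scalerDr lquot_piD.
Qed.
Fact lquot_scaleDl u : {morph lquot_scale^~ u : a b / a + b}.
Proof.
by move=> a b; rewrite -[u]lquot_pi_repr !lquot_scaleE scalerDl lquot_piD.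
Qed.
HB.instance Definition _ := GRing.Zmodule_isLmodule.Build F lquot
  lquot_scaleA lquot_scale1 lquot_scaleDr lquot_scaleDl.

Fact lquot_pi_linear : linear lquot_pi.
Proof. by move=> a x y; rewrite lquot_piD -lquot_scaleE. Qed.
HB.instance Definition _ := GRing.isLinear.Build F V lquot _ lquot_pi
  lquot_pi_linear.

End LinearQuotient.

Section Subquotient.
Variables (F : fieldType) (V : lmodType F) (Z B : submodClosed V).

Record subspace_of := SubspaceOf { subspace_val :> V; _ : subspace_val \in Z }.
HB.instance Definition _ := [isSub for subspace_val].
HB.instance Definition _ := [Choice of subspace_of by <:].
HB.instance Definition _ := [SubChoice_isSubLmodule of subspace_of by <:].

Definition subspace_pre : {pred subspace_of} := fun u => val u \in B.
Fact subspace_pre_closed : submod_closed subspace_pre.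
Proof.
split=> [|a u v Bu Bv]; first exact: (rpred0 B).
have: a *: val u + val v \in B by rewrite rpredD ?rpredZ.
by rewrite unfold_in.
Qed.
HB.instance Definition _ :=
  GRing.isSubmodClosed.Build F subspace_of subspace_pre subspace_pre_closed.

(* The quotient Z / B, that is Z / (Z :&: B) when B is not contained in Z. *)
Definition subquot := lquot subspace_pre.
HB.instance Definition _ := GRing.Lmodule.on subquot.

(* The class of x in Z / B; the junk value 0 when x is not in Z. *)
Definition cls (x : V) : subquot := lquot_pi subspace_pre (insubd 0 x).

(* The image in Z / B of the elements of Z that lie in D. *)
Definition cls_image (D : {pred V}) : {pred subquot} :=
  fun e => `[< exists x, [/\ x \in Z, x \in D & e = cls x] >].

Lemma clsP x y : x \in Z -> y \in Z -> (cls x = cls y) <-> (x - y \in B).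
Proof.
move=> Zx Zy; rewrite /cls lquot_piP unfold_in /subspace_pre /= -/(val _).
by rewrite !insubdK.
Qed.

Lemma cls_linear a x y : x \in Z -> y \in Z -> cls (a *: x + y) = a *: cls x + cls y.
Proof.
move=> Zx Zy; rewrite /cls -linearP; congr lquot_pi.
apply: val_inj; rewrite linearP /= -!/(val _) !insubdK //.
by rewrite [_ \in _]rpredD ?rpredZ.
Qed.

Lemma cls_surj e : exists2 x, x \in Z & e = cls x.
Proof.
exists (val (repr (e : lquot _))); first exact: valP.
by rewrite /cls valKd lquot_pi_repr.
Qed.

End Subquotient.
Arguments cls {F V} Z B x.
Arguments cls_image {F V} Z B D _.

Section KernelImage.
Variables (F : fieldType) (U V : lmodType F) (f : {linear U -> V}).

Definition lkernel : {pred U} := fun u => f u == 0.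
Fact lkernel_closed : submod_closed lkernel.
Proof.
split=> [|a u v]; rewrite !unfold_in ?linear0 // => /eqP fu /eqP fv.
by rewrite linearP fu fv scaler0 addr0.
Qed.
HB.instance Definition _ := GRing.isSubmodClosed.Build F U lkernel lkernel_closed.

Definition limage : {pred V} := fun v => `[< exists u, v = f u >].
Fact limage_closed : submod_closed limage.
Proof.
split=> [|a v w]; first by apply/asboolP; exists 0; rewrite linear0.
move=> /asboolP[x ->] /asboolP[y ->].
by apply/asboolP; exists (a *: x + y); rewrite linearP.
Qed.
HB.instance Definition _ := GRing.isSubmodClosed.Build F V limage limage_closed.

End KernelImage.

(* The filtration and the grading are indexed by int, with K_j = K for j <= 0,
   K_j = 0 for j > S, and K^k = 0 for k outside [0, n]. *)
Record filtered_graded_complex (F : fieldType) (K : lmodType F) (S n : nat) :=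
  FilteredGradedComplex {
    diff : {linear K -> K};
    fil : int -> submodClosed K;
    gr : int -> submodClosed K;
    diff_diff : forall x, diff (diff x) = 0;
    fil_full : forall j x, j <= 0 -> x \in fil j;
    fil_zero : forall j x, S%:Z < j -> x \in fil j -> x = 0;
    fil_decr : forall j, {subset fil (j + 1) <= fil j};
    fil_diff : forall j x, x \in fil j -> diff x \in fil j;
    gr_zero : forall k x, ~~ (0 <= k <= n%:Z) -> x \in gr k -> x = 0;
    gr_sum : is_direct_sum (fun k : 'I_n.+1 => gr k%:Z : {pred K}) predT;
    gr_diff : forall k x, x \in gr k -> diff x \in gr (k + 1);
    gr_fil : forall k, {subset gr k <= fil k};
    fil_gr_sum : forall j,
      is_direct_sum (fun k : 'I_n.+1 => [predI fil j & gr k%:Z] : {pred K})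
                    (fil j)
  }.

(* cpl j k is the chosen complement K^k_(j). Outside 0 <= j <= S and
   0 <= k <= n, cpl_sum forces it to be 0. *)
Record splitting (F : fieldType) (K : lmodType F) (S n : nat)
    (C : filtered_graded_complex K S n) := Splitting {
  cpl : int -> int -> submodClosed K;
  cpl_sum : forall j k,
    is_direct_sum2 (cpl j k) [predI fil C (j + 1) & gr C k]
                   [predI fil C j & gr C k]
}.

Section Pages.
Variables (F : fieldType) (K : lmodType F) (S n : nat).
Variable C : filtered_graded_complex K S n.
Local Notation d := (diff C).

Definition ssZ (r : nat) (p : int) : {pred K} :=
  fun c => (c \in fil C p) && (d c \in fil C (p + r%:Z)).

Lemma ssZE r p c : (c \in ssZ r p) = (c \in fil C p) && (d c \in fil C (p + r%:Z)).
Proof. by []. Qed.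

Fact ssZ_closed r p : submod_closed (ssZ r p).
Proof.
split=> [|a x y]; rewrite !ssZE ?linear0 ?rpred0 //.
by move=> /andP[? ?] /andP[? ?]; rewrite linearP !rpredD ?rpredZ.
Qed.
HB.instance Definition _ r p :=
  GRing.isSubmodClosed.Build F K (ssZ r p) (ssZ_closed r p).

(* Meant for r >= 1. *)
Definition ssB (r : nat) (p : int) : {pred K} :=
  fun x => `[< exists a b, [/\ a \in ssZ r.-1 (p + 1),
                              b \in ssZ r.-1 (p - (r.-1)%:Z) &
                              x = a + d b] >].

Fact ssB_closed r p : submod_closed (ssB r p).
Proof.
split=> [|t x y].
  by apply/asboolP; exists 0, 0; rewrite linear0 addr0 !rpred0.
move=> /asboolP[a [b [Za Zb ->]]] /asboolP[a' [b' [Za' Zb' ->]]].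
apply/asboolP; exists (t *: a + a'), (t *: b + b').
by split; rewrite ?rpredD ?rpredZ // linearP scalerDr addrACA.
Qed.
HB.instance Definition _ r p :=
  GRing.isSubmodClosed.Build F K (ssB r p) (ssB_closed r p).

Definition page (r : nat) (p : int) := subquot (ssZ r p) (ssB r p).
HB.instance Definition _ r p := GRing.Lmodule.on (page r p).

Definition pcls r p (x : K) : page r p := cls (ssZ r p) (ssB r p) x.

(* The part of total degree k, i.e., of bidegree (p, k - p). *)
Definition page_deg r p (k : int) : {pred page r p} :=
  cls_image (ssZ r p) (ssB r p) (gr C k).

End Pages.
Arguments page_deg {F K S n} C r p k _.

Section Splitting.
Variables (F : fieldType) (K : lmodType F) (S n : nat).
Variables (C : filtered_graded_complex K S n) (G : splitting C).
Local Notation d := (diff C).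

(* K_(j) *)
Definition part (j : int) : {pred K} :=
  fun x => `[< exists2 u : {ffun 'I_n.+1 -> K},
      forall k, u k \in cpl G j k%:Z & x = \sum_k u k >].

Fact part_closed j : submod_closed (part j).
Proof.
split=> [|a x y].
  by apply/asboolP; exists 0 => [k|]; rewrite ?big1 // => *; rewrite !ffunE ?rpred0.
move=> /asboolP[u Gu ->] /asboolP[v Gv ->].
apply/asboolP; exists [ffun k => a *: u k + v k] => [k|].
  by rewrite ffunE rpredD ?rpredZ.
by rewrite scaler_sumr -big_split; apply: eq_bigr => k _; rewrite ffunE.
Qed.
HB.instance Definition _ j := GRing.isSubmodClosed.Build F K (part j) (part_closed j).

Definition decomposes (x : K) (u : int -> K) :=
  (forall j, u j \in part j) /\ x = \sum_(j < S.+1) u j%:Z.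

Lemma cpl_sub j k x : x \in cpl G j k -> x \in fil C j /\ x \in gr C k.
Proof.
move=> Gx; have [h _] := cpl_sum G j k.
have := h x 0 Gx; rewrite addr0 => /(_ _)/andP[] //.
by rewrite inE /= !rpred0.
Qed.

Lemma cpl_cap j k x : x \in cpl G j k -> x \in fil C (j + 1) -> x = 0.
Proof.
move=> Gx Fx; have [fx gx] := cpl_sub Gx.
have [_ /(_ x)] := cpl_sum G j k.
rewrite inE /= fx gx => /(_ isT)[ab [_ ab_uniq]].
have e1 : ab = (x, 0) by apply: ab_uniq; rewrite /= addr0 inE /= !rpred0.
have e2 : ab = (0, x) by apply: ab_uniq; rewrite /= add0r rpred0 inE /= Fx gx.
by move: e1; rewrite e2 => -[].
Qed.


Lemma gr_indep (u : 'I_n.+1 -> K) :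
  (forall k, u k \in gr C k%:Z) -> \sum_k u k = 0 -> forall k, u k = 0.
Proof.
move=> Gu su; have [_ /(_ 0 isT)[w [_ w_uniq]]] := gr_sum C.
have e1 : w = [ffun k => u k].
  apply: w_uniq; split=> [k|]; first by rewrite ffunE.
  by rewrite -[LHS]su; apply: eq_bigr => k _; rewrite ffunE.
have e2 : w = [ffun k => 0].
  apply: w_uniq; split=> [k|]; first by rewrite ffunE rpred0.
  by rewrite big1 // => k _; rewrite ffunE.
by move=> k; have /ffunP/(_ k) := etrans (esym e1) e2; rewrite !ffunE.
Qed.

Lemma fil_mono i j : i <= j -> {subset fil C j <= fil C i}.
Proof.
move=> ij; have -> : j = i + `|j - i|%N%:Z by lia.
elim: `|_|%N => [|m IHm] x; first by rewrite addr0.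
by rewrite intS addrCA addrC => /fil_decr/IHm.
Qed.

Lemma partP j x : x \in part j <-> exists2 u : {ffun 'I_n.+1 -> K},
  forall k, u k \in cpl G j k%:Z & x = \sum_k u k.
Proof. by split=> [/asboolP|h]; [|apply/asboolP]. Qed.

Lemma part_fil j x : x \in part j -> x \in fil C j.
Proof.
by move=> /partP[u Gu ->]; apply: rpred_sum => k _; case: (cpl_sub (Gu k)).
Qed.

Lemma part_cap j x : x \in part j -> x \in fil C (j + 1) -> x = 0.
Proof.
move=> /partP[u Gu xE] Fx.
have [_ /(_ x Fx)[v [[Gv xE'] _]]] := fil_gr_sum C (j + 1).
have {}Gv k : v k \in fil C (j + 1) /\ v k \in gr C k%:Z.
  by have := Gv k; rewrite inE => /andP[].
have uv k : u k = v k.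
  apply/eqP; rewrite -subr_eq0; apply/eqP.
  apply: (@gr_indep (fun k => u k - v k)) => [i|].
    by rewrite -scaleN1r rpredD ?rpredZ //; [case: (cpl_sub (Gu i))|case: (Gv i)].
  by rewrite sumrB -xE -xE' subrr.
rewrite xE big1 // => k _; apply: (cpl_cap (Gu k)).
by rewrite uv; case: (Gv k).
Qed.

Lemma cpl_part j k x : x \in cpl G j k -> x \in part j.
Proof.
move=> Gx; have [/andP[k0 kn]|kN] := boolP (0 <= k <= n%:Z); last first.
  by have [_ /(gr_zero kN) ->] := cpl_sub Gx; exact: rpred0.
case: k k0 kn Gx => // k _ kn Gx; rewrite lez_nat -ltnS in kn.
apply/partP; exists [ffun i : 'I_n.+1 => if i == Ordinal kn then x else 0].
  by move=> i; rewrite ffunE; case: eqP => [->//|_]; exact: rpred0.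
rewrite (bigD1 (Ordinal kn)) //= big1 ?addr0 => [|i /negPf ni].
  by rewrite ffunE eqxx.
by rewrite ffunE ni.
Qed.

Lemma part_zero j x : ~~ (0 <= j <= S%:Z) -> x \in part j -> x = 0.
Proof.
rewrite negb_and -!ltNge => /orP[j0|jS] Px.
  by apply: part_cap Px _; apply: fil_full; lia.
by apply: fil_zero jS (part_fil Px).
Qed.

Lemma cpl_decomposes k x : x \in gr C k ->
  exists2 u, decomposes x u & forall j, u j \in cpl G j k.
Proof.
move=> gx; suff [u Gu xE] : exists2 u : int -> K,
    forall j, u j \in cpl G j k & x = \sum_(j < S.+1) u j%:Z.
  by exists u => //; split=> // j; apply: cpl_part (Gu j).
suff H m : (m <= S.+1)%N -> forall y, y \in gr C k -> y \in fil C (S.+1 - m)%N%:Z ->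
    exists2 u : int -> K, forall j, u j \in cpl G j k &
      (forall j, j < (S.+1 - m)%N%:Z -> u j = 0) /\ y = \sum_(j < S.+1) u j%:Z.
  have [|u Gu [_ xE]] := H S.+1 (leqnn _) x gx; last by exists u.
  by apply: fil_full; rewrite subnn.
elim: m => [_|m IHm mS] y gy Fy.
  exists (fun=> 0) => [j|]; first exact: rpred0.
  split=> //; rewrite big1 //; apply: fil_zero Fy; lia.
have [_ /(_ y)] := cpl_sum G (S.+1 - m.+1)%N%:Z k.
rewrite inE /= Fy gy => /(_ isT)[[a b] [[/= Ga Fb yE] _]].
move: Fb; rewrite inE => /andP[Fb gb].
have e : (S.+1 - m.+1)%N%:Z + 1 = (S.+1 - m)%N%:Z by lia.
rewrite e in Fb; have [u Gu [u0 bE]] := IHm (ltnW mS) b gb Fb.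
exists (fun j => if j == (S.+1 - m.+1)%N%:Z then a else u j) => [j|].
  by case: eqP => [->|].
split=> [j jm|].
  by case: eqP => [|_]; [lia | apply: u0; lia].
have lt : (S.+1 - m.+1 < S.+1)%N by lia.
rewrite yE bE [in RHS](bigD1 (Ordinal lt)) //= eqxx; congr (_ + _).
rewrite (bigD1 (Ordinal lt)) //= u0 ?add0r; last by lia.
apply: eq_bigr => i ni; case: eqP => // -[ie].
by case/eqP: ni; apply: val_inj.
Qed.

Lemma decomposes_exists x : exists u, decomposes x u.
Proof.
have [_ /(_ x isT)[w [[gw ->] _]]] := gr_sum C.
have H k : {u | decomposes (w k) u}.
  by apply: cid; have [u du _] := cpl_decomposes (gw k); exists u.
exists (fun j => \sum_k sval (H k) j); split=> [j|].
  by apply: rpred_sum => k _; case: (svalP (H k)).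
by rewrite exchange_big; apply: eq_bigr => k _; case: (svalP (H k)).
Qed.

Lemma decomposes_uniq x u v : decomposes x u -> decomposes x v -> u = v.
Proof.
move=> [Pu xu] [Pv xv]; apply/funext => j.
have [jS|jN] := boolP (0 <= j <= S%:Z); last first.
  by rewrite (part_zero jN (Pu j)) (part_zero jN (Pv j)).
pose w i := u i - v i.
have Pw i : w i \in part i by rewrite /w -scaleN1r rpredD ?rpredZ.
have sw : \sum_(i < S.+1) w i%:Z = 0 by rewrite sumrB -xu -xv subrr.
suff H : forall m : nat, (m < S.+1)%N -> w m%:Z = 0.
  by case: j jS => // m; rewrite lez_nat => /andP[_ mS]; apply/subr0_eq/H.
elim/ltn_ind => m IHm mS; apply: part_cap (Pw _) _.
move: sw; rewrite (bigD1 (Ordinal mS)) //= => /eqP.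
rewrite addr_eq0 => /eqP ->; rewrite -scaleN1r rpredZ // rpred_sum // => i ni.
have [im|mi|im] := ltngtP i m; first by rewrite (IHm i) ?rpred0.
  by apply: (fil_mono _ (part_fil (Pw _))); lia.
by case/eqP: ni; apply: val_inj.
Qed.

(* (x)_p *)
Definition component (p : int) (x : K) : K := sval (cid (decomposes_exists x)) p.

Lemma componentP x : decomposes x (component^~ x).
Proof. by rewrite /component; case: cid. Qed.

Lemma component_uniq x u p : decomposes x u -> component p x = u p.
Proof. by move=> /(decomposes_uniq (componentP x)) <-. Qed.

Lemma component_part p x : component p x \in part p.
Proof. by case: (componentP x). Qed.

Lemma component_sum x : x = \sum_(j < S.+1) component j%:Z x.
Proof. by case: (componentP x). Qed.

Fact component_linear p : linear (component p).
Proof.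
move=> a x y; apply: (@component_uniq _ (fun j => a *: component j x + component j y)).
split=> [j|]; first by rewrite rpredD ?rpredZ ?component_part.
by rewrite {1}(component_sum x) {1}(component_sum y) scaler_sumr big_split.
Qed.
HB.instance Definition _ p := GRing.isLinear.Build F K K _ (component p) (component_linear p).

Lemma component_id j x : x \in part j -> component j x = x.
Proof.
move=> Px; have [jN|jN] := boolP (0 <= j <= S%:Z); last first.
  by rewrite (part_zero jN Px) linear0.
rewrite (@component_uniq _ (fun i => if i == j then x else 0)) ?eqxx //.
split=> [i|]; first by case: eqP => [->|_] //; exact: rpred0.
case: j jN Px => // m; rewrite lez_nat -ltnS => /andP[_ mS] _.
rewrite (bigD1 (Ordinal mS)) //= eqxx big1 ?addr0 // => i ni.
by case: eqP => // -[im]; case/eqP: ni; apply: val_inj.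
Qed.

Lemma component_cpl p k x : x \in gr C k -> component p x \in cpl G p k.
Proof. by move=> /cpl_decomposes[u du Gu]; rewrite (component_uniq _ du). Qed.

Lemma component_fil p j x : x \in fil C j -> p < j -> component p x = 0.
Proof.
move=> Fx pj; have [/andP[p0 pS]|pN] := boolP (0 <= p <= S%:Z); last first.
  exact: part_zero pN (component_part _ _).
case: p p0 pS pj => // m _; rewrite lez_nat -ltnS.
elim/ltn_ind: m => m IHm mS mj; apply: part_cap (component_part _ _) _.
have := component_sum x; rewrite (bigD1 (Ordinal mS)) //= => /eqP.
rewrite -subr_eq => /eqP <-; rewrite -scaleN1r rpredD ?rpredZ ?rpred_sum //.
  by apply: (fil_mono _ Fx); lia.
move=> i ni; have [im|mi|im] := ltngtP i m.
- by rewrite IHm ?rpred0 //; lia.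
- by apply: (fil_mono _ (part_fil (component_part _ _))); lia.
by case/eqP: ni; apply: val_inj.
Qed.

(* d_(i); see dcomp_bideg and dcomp_sum *)
Definition dcomp (i : nat) (x : K) : K :=
  \sum_(j < S.+1) component (j%:Z + i%:Z) (d (component j%:Z x)).

Fact dcomp_linear i : linear (dcomp i).
Proof.
move=> a x y; rewrite scaler_sumr -big_split; apply: eq_bigr => j _.
by rewrite !linearP.
Qed.
HB.instance Definition _ i := GRing.isLinear.Build F K K _ (dcomp i) (dcomp_linear i).

Lemma dcompE i j x : x \in part j -> dcomp i x = component (j + i%:Z) (d x).
Proof.
move=> Px; have [jN|jN] := boolP (0 <= j <= S%:Z); last first.
  by rewrite (part_zero jN Px) !linear0.
case: j jN Px => // m; rewrite lez_nat -ltnS => /andP[_ mS] Px.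
have dx : decomposes x (fun i => if i == m%:Z then x else 0).
  split=> [l|]; first by case: eqP => [->|_] //; exact: rpred0.
  rewrite (bigD1 (Ordinal mS)) //= eqxx big1 ?addr0 // => l nl.
  by case: eqP => // -[lm]; case/eqP: nl; apply: val_inj.
rewrite /dcomp (bigD1 (Ordinal mS)) //= (component_id Px).
rewrite [X in _ + X]big1 ?addr0 // => l nl.
rewrite (component_uniq _ dx); case: eqP => [[lm]|_]; last by rewrite !linear0.
by case/eqP: nl; apply: val_inj.
Qed.

Lemma dcomp_bideg i j k x : x \in cpl G j k -> dcomp i x \in cpl G (j + i%:Z) (k + 1).
Proof.
move=> Gx; rewrite (dcompE _ (cpl_part Gx)); apply: component_cpl.
by apply: gr_diff; case: (cpl_sub Gx).
Qed.

Lemma dcomp_sum x : d x = \sum_(i < S.+1) dcomp i x.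
Proof.
rewrite exchange_big {1}(component_sum x) linear_sum; apply: eq_bigr => j _ /=.
set y := d _.
have Fy : y \in fil C j%:Z by apply/fil_diff/part_fil/component_part.
have H (f : int -> K) : (forall i : nat, (S < i)%N -> f i%:Z = 0) ->
    (forall i : nat, (i < j)%N -> f i%:Z = 0) ->
    \sum_(i < S.+1) f i%:Z = \sum_(i < S.+1) f (j%:Z + i%:Z).
  move=> fS fj; rewrite -(big_mkord xpredT (fun i => f i%:Z)).
  rewrite -(big_mkord xpredT (fun i => f (j%:Z + i%:Z))).
  rewrite (@big_cat_nat _ _ _ j) //=; last exact: ltnW.
  rewrite big1_seq ?add0r => [|i]; last by rewrite mem_index_iota => /fj.
  rewrite -{1}[j : nat]add0n big_addn.
  rewrite [RHS](@big_cat_nat _ _ _ (S.+1 - j)) //=; last exact: leq_subr.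
  rewrite [X in _ = _ + X]big1_seq ?addr0.
    by apply: eq_bigr => i _; rewrite addnC PoszD.
  move=> i; rewrite mem_index_iota => /andP[h1 h2]; rewrite -PoszD fS //; lia.
rewrite {1}(component_sum y); apply: (H (component^~ y)) => i hi.
  by apply: part_zero (component_part _ _); lia.
by apply: component_fil Fy _.
Qed.

(* z j stands for the element z_{p+j} of K_(p+j). *)
Definition cocycle_data (r : nat) (p : int) (x : K) (z : nat -> K) :=
  (forall j, (1 <= j < r)%N -> z j \in part (p + j%:Z)) /\
  (forall m, (1 <= m < r)%N ->
     dcomp m x = \sum_(0 <= i < m) dcomp i (z (m - i)%N)).

(* c k stands for the element c_{p-k} of K_(p-k). *)
Definition coboundary_data (r : nat) (p : int) (x : K) (c : nat -> K) :=
  [/\ forall k, (k < r)%N -> c k \in part (p - k%:Z),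
      x = \sum_(0 <= k < r) dcomp k (c k) &
      forall l, (1 <= l < r)%N -> 0 = \sum_(l <= k < r) dcomp (k - l) (c k)].

Definition Zr (r : nat) (p : int) : {pred K} :=
  fun x => `[< [/\ x \in part p, dcomp 0 x = 0 & exists z, cocycle_data r p x z] >].

Definition Br (r : nat) (p : int) : {pred K} :=
  fun x => `[< exists c, coboundary_data r p x c >].

Fact Zr_closed r p : submod_closed (Zr r p).
Proof.
split=> [|a x y].
  apply/asboolP; split; rewrite ?rpred0 ?linear0 //; exists (fun=> 0).
  split=> [j _|m _]; first exact: rpred0.
  by rewrite linear0 big1 // => i _; rewrite linear0.
move=> /asboolP[Px x0 [u [Pu uE]]] /asboolP[Py y0 [v [Pv vE]]].
apply/asboolP; split; first by rewrite rpredD ?rpredZ.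
  by rewrite linearP /= x0 y0 scaler0 addr0.
exists (fun j => a *: u j + v j); split=> [j jr|m mr].
  by rewrite rpredD ?rpredZ ?Pu ?Pv.
rewrite linearP /= uE // vE // scaler_sumr -big_split.
by apply: eq_bigr => i _; rewrite linearP.
Qed.
HB.instance Definition _ r p :=
  GRing.isSubmodClosed.Build F K (Zr r p) (Zr_closed r p).

Fact Br_closed r p : submod_closed (Br r p).
Proof.
split=> [|a x y].
  apply/asboolP; exists (fun=> 0); split=> [k _||l _]; first exact: rpred0.
    by rewrite big1 // => i _; rewrite linear0.
  by rewrite big1 // => i _; rewrite linear0.
move=> /asboolP[u [Pu uE u0]] /asboolP[v [Pv vE v0]].
apply/asboolP; exists (fun j => a *: u j + v j); split=> [k kr||l lr].
- by rewrite rpredD ?rpredZ ?Pu ?Pv.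
- rewrite uE vE scaler_sumr -big_split.
  by apply: eq_bigr => i _; rewrite linearP.
transitivity (a *: (\sum_(l <= k < r) dcomp (k - l) (u k)) +
              \sum_(l <= k < r) dcomp (k - l) (v k)).
  by rewrite -u0 // -v0 // scaler0 addr0.
rewrite scaler_sumr -big_split.
by apply: eq_bigr => i _; rewrite linearP.
Qed.
HB.instance Definition _ r p :=
  GRing.isSubmodClosed.Build F K (Br r p) (Br_closed r p).

Definition ZBquot (r : nat) (p : int) := subquot (Zr r p) (Br r p).
HB.instance Definition _ r p := GRing.Lmodule.on (ZBquot r p).

Definition zbcls r p (x : K) : ZBquot r p := cls (Zr r p) (Br r p) x.

(* The part of total degree k, i.e., of bidegree (p, k - p). *)
Definition ZBquot_deg r p (k : int) : {pred ZBquot r p} :=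
  cls_image (Zr r p) (Br r p) (gr C k).

End Splitting.
Arguments ZBquot_deg {F K S n C} G r p k _.

(* Every integer has the form p + r, so sseq_homology covers all bidegrees. *)
Record is_spectral_sequence (F : fieldType) (K : lmodType F) (S n : nat)
    (C : filtered_graded_complex K S n)
    (dE : forall (r : nat) (p : int), {linear page C r p -> page C r (p + r%:Z)})
    : Prop := IsSpectralSequence {
  sseq_sub : forall r p, (0 < r)%N -> {subset ssB C r p <= ssZ C r p};
  sseq_bigraded : forall r p, (0 < r)%N ->
    is_direct_sum (fun k : 'I_n.+1 => page_deg C r p k%:Z)
                  predT;
  sseq_diff : forall r p x, (0 < r)%N -> x \in ssZ C r p ->
    diff C x \in ssZ C r (p + r%:Z) /\
    dE r p (pcls C r p x) = pcls C r (p + r%:Z) (diff C x);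
  sseq_bidegree : forall r p k e, (0 < r)%N -> e \in page_deg C r p k ->
    dE r p e \in page_deg C r (p + r%:Z) (k + 1);
  sseq_diff_diff : forall r p e, (0 < r)%N -> dE r (p + r%:Z) (dE r p e) = 0;
  sseq_homology : forall r p, (0 < r)%N ->
    exists2 h : {linear page C r.+1 (p + r%:Z) ->
                   subquot (lkernel (dE r (p + r%:Z))) (limage (dE r p))},
      bijective h &
      forall x, x \in ssZ C r.+1 (p + r%:Z) ->
        pcls C r (p + r%:Z) x \in lkernel (dE r (p + r%:Z)) /\
        h (pcls C r.+1 (p + r%:Z) x) =
          cls (lkernel (dE r (p + r%:Z))) (limage (dE r p))
              (pcls C r (p + r%:Z) x)
}.

(* Main.v *)
From HB Require Import structures.
Require Import Defs.
From mathcomp Require Import all_boot all_order all_algebra.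
From mathcomp Require Import boolp zify.

Set Implicit Arguments.
Unset Strict Implicit.
Unset Printing Implicit Defensive.

Import Order.TTheory GRing.Theory Num.Theory.
Local Open Scope ring_scope.

(** The filtration gives its usual spectral sequence, with pages ssZ / ssB and
    differential [x] |-> [dx]; what is special to a split filtration is that
    taking leading components (x)_p turns these pages into Zr / Br.

    A chain c of K_p is a finite sum of components c_p + c_(p+1) + ..., and
    the component of dc in degree p + m is the sum of the d_(m-j) c_(p+j) for
    j <= m. So dc lies in K_(p+r) exactly when the first r of these sums
    vanish, and for c = x - z_(p+1) - ... - z_(p+r-1) they are the equations
    that define Zr: thus Zr consists of the leading components of the elements
    of ssZ (ZrP), a choice of the z's being a choice of such a lift
    (corrected_ssZ). Likewise, the equations that define Br say that
    b = c_p + c_(p-1) + ... + c_(p-r+1) has db in K_p, and that x is the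
    leading component of db (BrP).

    Hence the map x |-> (x)_p sends ssZ onto Zr and ssB into Br. Conversely, if
    (x)_p = (db)_p with b as above, then x - db is in K_(p+1) and has the same
    differential as x, so x is in ssB (component_ssB). The induced map
    leading_iso is therefore an isomorphism, and it transports the
    differential of the page. To compute the transported differential at [x],
    take the lift c = x - (the sum of the z's) of x: the image is the class of
    (dc)_(p+r), and the formula for the components of dc gives the stated
    expression.

    The bigrading is handled through the projections hom_part onto the
    homogeneous parts: they preserve the filtration, commute with components,
    and commute with d up to the shift of degree, so they act on ssZ and ssB. *)

(** * Linear maps between subquotients *)

Section SubquotientMaps.
Variable F : fieldType.

Lemma submodN (V : lmodType F) (W : submodClosed V) x : x \in W -> - x \in W.
Proof. by move=> Wx; rewrite -scaleN1r rpredZ. Qed.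

Lemma submodB (V : lmodType F) (W : submodClosed V) x y :
  x \in W -> y \in W -> x - y \in W.
Proof. by move=> Wx Wy; rewrite rpredD ?submodN. Qed.

Lemma linear_surj_bij (U V : lmodType F) (h : {linear U -> V}) :
  (forall u, h u = 0 -> u = 0) -> (forall v, exists u, h u = v) -> bijective h.
Proof.
move=> h_inj h_surj; pose g v := sval (cid (h_surj v)).
have gK : cancel g h by move=> v; exact: svalP (cid (h_surj v)).
exists g => // u; apply/subr0_eq/h_inj.
by rewrite linearB /= gK subrr.
Qed.

(** Used to transport the differential of a page through an isomorphism. *)
Lemma linear_factor (U V W : lmodType F) (h : {linear U -> V})
    (k : {linear U -> W}) :
  bijective h -> exists k' : {linear V -> W}, forall u, k' (h u) = k u.
Proof.
case=> g hK gK; have g_lin : linear g := can2_linear hK gK.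
have k'_lin : linear (fun v => k (g v)) by move=> a u v; rewrite g_lin linearP.
pose m := GRing.isLinear.Build F V W _ _ k'_lin.
pose k' : {linear V -> W} := HB.pack (fun v => k (g v)) m.
by exists k' => u /=; rewrite hK.
Qed.

(** The map f need only be linear on Z: the class map of a subquotient, which is
    one of the maps that this is applied to, has a junk value outside Z. *)
Lemma subquot_map (V W : lmodType F) (Z B : submodClosed V)
    (Z' B' : submodClosed W) (f : V -> W) :
    (forall a, {in Z &, forall x y, f (a *: x + y) = a *: f x + f y}) ->
    {in Z, forall x, f x \in Z'} ->
    {in Z, forall x, x \in B -> f x \in B'} ->
  exists h : {linear subquot Z B -> subquot Z' B'},
    {in Z, forall x, h (cls Z B x) = cls Z' B' (f x)}.
Proof.
move=> f_lin fZ fB.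
pose h (e : subquot Z B) : subquot Z' B' :=
  cls Z' B' (f (s2val (cid2 (cls_surj e)))).
have hE : {in Z, forall x, h (cls Z B x) = cls Z' B' (f x)}.
  move=> x Zx; rewrite /h; case: cid2 => y /= Zy.
  move/(clsP _ Zx Zy) => Bxy; apply/clsP; rewrite ?fZ //.
  have -> : f y - f x = f (-1 *: x + y) by rewrite f_lin // scaleN1r addrC.
  rewrite scaleN1r addrC -opprB.
  by apply: fB; apply: submodN => //; apply: submodB.
have h_lin : linear h.
  move=> a e e'; have [x Zx ->] := cls_surj e; have [y Zy ->] := cls_surj e'.
  rewrite -cls_linear // !hE ?rpredD ?rpredZ //.
  by rewrite f_lin // cls_linear ?fZ.
pose m := GRing.isLinear.Build F _ _ _ _ h_lin.
pose h' : {linear subquot Z B -> subquot Z' B'} := HB.pack h m.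
by exists h'.
Qed.

Lemma cls_eq0 (V : lmodType F) (Z B : submodClosed V) (x : V) :
  x \in Z -> (cls Z B x = 0) <-> (x \in B).
Proof.
move=> Zx; have e0 : cls Z B 0 = 0.
  have := cls_linear B 1 (rpred0 Z) (rpred0 Z).
  by rewrite !scale1r addr0 => /esym/eqP; rewrite addrC -subr_eq0 addrK => /eqP.
by have := clsP B Zx (rpred0 Z); rewrite e0 subr0.
Qed.

Lemma subquot_iso (V W : lmodType F) (Z B : submodClosed V)
    (Z' B' : submodClosed W) (f : V -> W) :
    (forall a, {in Z &, forall x y, f (a *: x + y) = a *: f x + f y}) ->
    {in Z, forall x, f x \in Z'} ->
    {in Z, forall x, (x \in B) = (f x \in B')} ->
    {in Z', forall y, exists2 x, x \in Z & f x - y \in B'} ->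
  exists2 h : {linear subquot Z B -> subquot Z' B'},
    bijective h & {in Z, forall x, h (cls Z B x) = cls Z' B' (f x)}.
Proof.
move=> f_lin fZ fB f_surj.
have [|h hE] := subquot_map (B := B) (B' := B') f_lin fZ.
  by move=> x Zx; rewrite fB.
exists h => //; apply: linear_surj_bij => [u|v].
  have [x Zx ->] := cls_surj u; rewrite hE //.
  by move/(cls_eq0 _ (fZ x Zx)) => B'fx; apply/cls_eq0; rewrite // fB.
have [y Zy ->] := cls_surj v; have [x Zx B'xy] := f_surj y Zy.
by exists (cls Z B x); rewrite hE //; apply/clsP; rewrite ?fZ.
Qed.

End SubquotientMaps.

(** * Homogeneous parts *)

Section Homogeneous.
Variables (F : fieldType) (K : lmodType F) (S n : nat).
Variable C : filtered_graded_complex K S n.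
Local Notation d := (diff C).

Fact hom_decomposition x : exists u : {ffun 'I_n.+1 -> K},
  (forall k, u k \in gr C k%:Z) /\ x = \sum_k u k.
Proof. by have [_ /(_ x isT)[u [uP _]]] := gr_sum C; exists u. Qed.

(** At most one index contributes to the sum; writing it so lets k range over all
    integers, the value being 0 outside [0, n], which makes the commutation with
    d uniform at both ends of the grading. *)
Definition hom_part (k : int) (x : K) : K :=
  \sum_(i < n.+1 | i%:Z == k) sval (cid (hom_decomposition x)) i.

Lemma hom_part_gr k x : hom_part k x \in gr C k.
Proof.
apply: rpred_sum => i /eqP <-.
by case: (svalP (cid (hom_decomposition x))) => h _; apply: h.
Qed.

Lemma sum_ord_delta (f : 'I_n.+1 -> K) (i : 'I_n.+1) :
  \sum_(j < n.+1 | j%:Z == i%:Z) f j = f i.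
Proof. by apply: big_pred1 => j; rewrite eqz_nat. Qed.

Lemma hom_part_sum x : x = \sum_(i < n.+1) hom_part i%:Z x.
Proof.
have [_ {1}->] := svalP (cid (hom_decomposition x)).
by apply: eq_bigr => i _; rewrite /hom_part sum_ord_delta.
Qed.

Lemma hom_part_uniq (v : int -> K) x k :
  (forall i, v i \in gr C i) -> x = \sum_(i < n.+1) v i%:Z -> hom_part k x = v k.
Proof.
move=> Gv xE; have [kn|kN] := boolP (0 <= k <= n%:Z); last first.
  by rewrite (gr_zero kN (Gv k)) (gr_zero kN (hom_part_gr k x)).
case: k kn => // m; rewrite lez_nat -ltnS => /andP[_ mn].
apply/subr0_eq.
apply: (@gr_indep _ _ _ _ C (fun i => hom_part i%:Z x - v i%:Z) _ _ (Ordinal mn)).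
  by move=> i; rewrite -scaleN1r rpredD ?rpredZ ?hom_part_gr.
by rewrite sumrB -hom_part_sum -xE subrr.
Qed.

Fact hom_part_linear k : linear (hom_part k).
Proof.
move=> a x y.
apply: (hom_part_uniq (v := fun i => a *: hom_part i x + hom_part i y)) => [i|].
  by rewrite rpredD ?rpredZ ?hom_part_gr.
by rewrite {1}(hom_part_sum x) {1}(hom_part_sum y) scaler_sumr big_split.
Qed.
HB.instance Definition _ k :=
  GRing.isLinear.Build F K K _ (hom_part k) (hom_part_linear k).

Lemma hom_part_id k x : x \in gr C k -> hom_part k x = x.
Proof.
move=> Gx; have [kn|kN] := boolP (0 <= k <= n%:Z); last first.
  by rewrite (gr_zero kN Gx) linear0.
rewrite (@hom_part_uniq (fun i => if i == k then x else 0)) ?eqxx // => [i|].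
  by case: eqP => [->|_] //; exact: rpred0.
case: k kn Gx => // m; rewrite lez_nat -ltnS => /andP[_ mn] _.
by rewrite -big_mkcond /= (sum_ord_delta (fun=> x) (Ordinal mn)).
Qed.

(** This is where the compatibility of the filtration with the grading enters:
    the decomposition of x inside K_j is also its decomposition in K. *)
Lemma hom_part_fil j k x : x \in fil C j -> hom_part k x \in fil C j.
Proof.
move=> Fx; have [_ /(_ x Fx)[w [[Gw xE] _]]] := fil_gr_sum C j.
have {}Gw i : w i \in fil C j /\ w i \in gr C i%:Z.
  by have := Gw i; rewrite inE => /andP[].
rewrite (hom_part_uniq (v := fun l => \sum_(i < n.+1 | i%:Z == l) w i)).
- by apply: rpred_sum => i _; case: (Gw i).
- by move=> l; apply: rpred_sum => i /eqP <-; case: (Gw i).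
by rewrite {1}xE; apply: eq_bigr => i _; rewrite sum_ord_delta.
Qed.

Lemma hom_part_diff k x : hom_part k (d x) = d (hom_part (k - 1) x).
Proof.
have Gd l : d (hom_part (l - 1) x) \in gr C l.
  by have := gr_diff (hom_part_gr (l - 1) x); rewrite subrK.
apply: (hom_part_uniq (v := fun k => d (hom_part (k - 1) x))) => //.
(* The shift of the index loses the term of degree n on one side and gains the
   term of degree -1 on the other; both vanish. *)
rewrite {1}(hom_part_sum x) linear_sum big_ord_recr big_ord_recl /=.
have -> : d (hom_part n%:Z x) = 0.
  have := Gd (n%:Z + 1); rewrite addrK; apply: gr_zero; lia.
have -> : hom_part (0 - 1) x = 0 by apply: gr_zero (hom_part_gr _ _).
rewrite linear0 addr0 add0r; apply: eq_bigr => i _.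
by congr (d (hom_part _ x)); rewrite /= /bump /=; lia.
Qed.

Lemma ssZ_hom_part r p k x : x \in ssZ C r p -> hom_part k x \in ssZ C r p.
Proof.
rewrite !ssZE => /andP[Fx Fdx]; rewrite hom_part_fil //=.
by have := hom_part_fil (k + 1) Fdx; rewrite hom_part_diff addrK.
Qed.

Lemma ssBP r p x : (x \in ssB C r p) <->
  exists a b, [/\ a \in ssZ C r.-1 (p + 1), b \in ssZ C r.-1 (p - (r.-1)%:Z) &
                  x = a + d b].
Proof. by split=> [/asboolP|h]; [|apply/asboolP]. Qed.

Lemma ssB_hom_part r p k x : x \in ssB C r p -> hom_part k x \in ssB C r p.
Proof.
move=> /ssBP[a [b [Za Zb ->]]]; apply/ssBP.
exists (hom_part k a), (hom_part (k - 1) b); split; try exact: ssZ_hom_part.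
by rewrite linearD /= hom_part_diff.
Qed.

End Homogeneous.

(** * The spectral sequence of the filtration *)

Section SpectralSequence.
Variables (F : fieldType) (K : lmodType F) (S n : nat).
Variable C : filtered_graded_complex K S n.
Local Notation d := (diff C).

Lemma ssB_sub r p : (0 < r)%N -> {subset ssB C r p <= ssZ C r p}.
Proof.
move=> r0 x /ssBP[a [b [/andP[Fa Fda] /andP[Fb Fdb] ->]]].
apply/andP; rewrite linearD /= diff_diff addr0; split.
  by apply: rpredD; [apply: (fil_mono _ Fa) | apply: (fil_mono _ Fdb)]; lia.
by apply: (fil_mono _ Fda); lia.
Qed.

Lemma ssB_left r p x : x \in ssZ C r.-1 (p + 1) -> x \in ssB C r p.
Proof. by move=> Zx; apply/ssBP; exists x, 0; rewrite rpred0 linear0 addr0. Qed.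

Lemma ssZ_diff r p x : x \in ssZ C r p -> d x \in ssZ C r (p + r%:Z).
Proof. by case/andP=> _ Fdx; apply/andP; rewrite diff_diff rpred0. Qed.

Lemma ssB_diff r p x : (0 < r)%N -> x \in ssB C r p -> d x \in ssB C r (p + r%:Z).
Proof.
move=> r0 /ssBP[a [b [Za Zb ->]]]; rewrite linearD /= diff_diff addr0.
apply/ssBP; exists 0, a; rewrite rpred0 add0r; split=> //.
by have -> : p + r%:Z - r.-1%:Z = p + 1 by lia.
Qed.

(** The pages are only meaningful for r >= 1; the zero map at r = 0 merely makes
    the family of differentials total. *)
Lemma page_diff_exists r p : exists dE : {linear page C r p -> page C r (p + r%:Z)},
  (0 < r)%N -> {in ssZ C r p, forall x, dE (pcls C r p x) = pcls C r (p + r%:Z) (d x)}.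
Proof.
case: r => [|r]; first by exists (\0).
have [|||h hE] := @subquot_map F K K (ssZ C r.+1 p) (ssB C r.+1 p)
  (ssZ C r.+1 (p + r.+1%:Z)) (ssB C r.+1 (p + r.+1%:Z)) d.
- by move=> a x y _ _; rewrite linearP.
- by move=> x; apply: ssZ_diff.
- by move=> x _; apply: ssB_diff.
by exists h.
Qed.

Definition page_diff r p := sval (cid (page_diff_exists r p)).

Lemma page_diffE r p x : (0 < r)%N -> x \in ssZ C r p ->
  page_diff r p (pcls C r p x) = pcls C r (p + r%:Z) (d x).
Proof. by move=> r0; apply: (svalP (cid (page_diff_exists r p))). Qed.

Lemma page_degP r p k e : e \in page_deg C r p k <->
  exists x, [/\ x \in ssZ C r p, x \in gr C k & e = pcls C r p x].
Proof. by split=> [/asboolP|h]; [|apply/asboolP]. Qed.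

Lemma pcls_sum r p (I : finType) (f : I -> K) : (forall i, f i \in ssZ C r p) ->
  pcls C r p (\sum_i f i) = \sum_i pcls C r p (f i).
Proof.
move=> Zf; suff [] : \sum_i f i \in ssZ C r p /\
  pcls C r p (\sum_i f i) = \sum_i pcls C r p (f i) by [].
apply: (big_ind2 (fun x e => x \in ssZ C r p /\ pcls C r p x = e)) => //.
  by split; [exact: rpred0 | apply/cls_eq0; exact: rpred0].
move=> x e y e' [Zx <-] [Zy <-]; split; first exact: rpredD.
by have := cls_linear (ssB C r p) 1 Zx Zy; rewrite !scale1r.
Qed.

(** The homogeneous parts of a representative represent the homogeneous parts of
    its class; they are unique because hom_part preserves ssB. *)
Lemma page_bigraded r p :
  is_direct_sum (fun k : 'I_n.+1 => page_deg C r p k%:Z) predT.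
Proof.
split=> // e _; have [x Zx ->] := cls_surj e.
exists [ffun k : 'I_n.+1 => pcls C r p (hom_part C k%:Z x)]; split.
  split=> [k|].
    rewrite ffunE; apply/page_degP; exists (hom_part C k%:Z x).
    by rewrite ssZ_hom_part ?hom_part_gr.
  rewrite -[LHS]/(pcls C r p x) {1}(hom_part_sum C x) pcls_sum.
    by apply: eq_bigr => k _; rewrite ffunE.
  by move=> k; apply: ssZ_hom_part.
move=> u [Du xE]; apply/ffunP => k; rewrite ffunE.
have {Du} y_ (i : 'I_n.+1) : {y | [/\ y \in ssZ C r p, y \in gr C i%:Z & u i = pcls C r p y]}.
  by apply: cid; apply/page_degP.
pose y i := sval (y_ i).
have Zy i : y i \in ssZ C r p by case: (svalP (y_ i)).
have Gy i : y i \in gr C i%:Z by case: (svalP (y_ i)).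
have uE i : u i = pcls C r p (y i) by case: (svalP (y_ i)).
have Bxy : x - \sum_i y i \in ssB C r p.
  have Zy' : \sum_i y i \in ssZ C r p by apply: rpred_sum.
  apply/(clsP _ Zx Zy'); rewrite xE [RHS](pcls_sum Zy).
  by apply: eq_bigr => i _; exact: uE.
rewrite uE; apply/clsP; rewrite ?ssZ_hom_part //.
have := ssB_hom_part k%:Z Bxy; rewrite linearB /=.
suff -> : hom_part C k%:Z (\sum_i y i) = y k by [].
rewrite (hom_part_uniq (v := fun l => \sum_(i < n.+1 | i%:Z == l) y i)) ?sum_ord_delta //.
  by move=> l; apply: rpred_sum => i /eqP <-.
by apply: eq_bigr => i _; rewrite sum_ord_delta.
Qed.

Lemma page_diff_ker r p x : (0 < r)%N -> x \in ssZ C r p ->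
  (pcls C r p x \in lkernel (page_diff r p)) <-> d x \in ssB C r (p + r%:Z).
Proof.
move=> r0 Zx; rewrite unfold_in page_diffE //.
have := cls_eq0 (ssB C r (p + r%:Z)) (ssZ_diff Zx).
by rewrite /pcls => <-; split=> /eqP.
Qed.

Lemma page_diff_im r p x : (0 < r)%N -> x \in ssZ C r (p + r%:Z) ->
  (pcls C r (p + r%:Z) x \in limage (page_diff r p)) <->
  exists2 b, b \in ssZ C r p & x - d b \in ssB C r (p + r%:Z).
Proof.
move=> r0 Zx; split=> [/asboolP[e]|[b Zb Bxb]].
  have [b Zb ->] := cls_surj e; rewrite [RHS]page_diffE //.
  by move/(clsP _ Zx (ssZ_diff Zb)) => h; exists b.
apply/asboolP; exists (pcls C r p b); rewrite page_diffE //.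
by apply/clsP; rewrite ?ssZ_diff.
Qed.

Lemma ssZS_sub r p : {subset ssZ C r.+1 p <= ssZ C r p}.
Proof.
by move=> x /andP[Fx Fdx]; apply/andP; split=> //; apply: (fil_mono _ Fdx); lia.
Qed.

Lemma ssZS_diff r p x : (0 < r)%N -> x \in ssZ C r.+1 p -> d x \in ssB C r (p + r%:Z).
Proof.
move=> r0 /andP[Fx Fdx]; apply: ssB_left; apply/andP.
rewrite diff_diff rpred0; split=> //; apply: (fil_mono _ Fdx); lia.
Qed.

(** An element of ssZ of level r + 1 dies on page r + 1 exactly when its class on
    page r is a boundary; the right-hand side is the one of page_diff_im. *)
Lemma ssB_succP r p x : (0 < r)%N -> x \in ssZ C r.+1 (p + r%:Z) ->
  (x \in ssB C r.+1 (p + r%:Z)) <->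
  exists2 b, b \in ssZ C r p & x - d b \in ssB C r (p + r%:Z).
Proof.
move=> r0 /andP[Fx Fdx]; split.
  move=> /ssBP[a [b [Za Zb ->]]]; rewrite /= addrK in Za Zb *.
  exists b => //; rewrite addrK; apply: ssB_left.
  by case: r r0 Za {Fx Fdx Zb} => // r _; apply: ssZS_sub.
case=> b Zb /ssBP[a [b' [/andP[Fa Fda] /andP[Fb' Fdb'] e]]].
(* As a differs from x by a boundary, da = dx, which gains one filtration step. *)
have aE : a = x - d (b + b') by rewrite linearD /= opprD addrA e addrK.
apply/ssBP; exists a, (b + b'); rewrite /= addrK; split; last by rewrite aE subrK.
  apply/andP; split=> //.
  by rewrite aE linearB /= diff_diff subr0; apply: (fil_mono _ Fdx); lia.
apply: rpredD => //; apply/andP; split.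
  by apply: (fil_mono _ Fb'); lia.
by apply: (fil_mono _ Fdb'); lia.
Qed.

(** The inclusion of ssZ of level r + 1 into that of level r induces the map. It is
    onto the kernel because if dx = a + db with a and b as in the definition of
    ssB, then x - b represents the same class as x on page r, while
    d(x - b) = a lies one step deeper in the filtration. *)
Lemma page_homology r p : (0 < r)%N ->
  exists2 h : {linear page C r.+1 (p + r%:Z) ->
      subquot (lkernel (page_diff r (p + r%:Z))) (limage (page_diff r p))},
    bijective h &
    forall x, x \in ssZ C r.+1 (p + r%:Z) ->
      pcls C r (p + r%:Z) x \in lkernel (page_diff r (p + r%:Z)) /\
      h (pcls C r.+1 (p + r%:Z) x) =
        cls (lkernel (page_diff r (p + r%:Z))) (limage (page_diff r p))
            (pcls C r (p + r%:Z) x).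
Proof.
move=> r0; set q := p + r%:Z.
have ker x : x \in ssZ C r.+1 q -> pcls C r q x \in lkernel (page_diff r q).
  move=> Zx; apply/(page_diff_ker r0 (ssZS_sub Zx)); exact: ssZS_diff.
have [||||h h_bij hE] := @subquot_iso F K (page C r q) (ssZ C r.+1 q) (ssB C r.+1 q)
  (lkernel (page_diff r q)) (limage (page_diff r p)) (pcls C r q).
- by move=> a x y Zx Zy; apply: cls_linear; apply: ssZS_sub.
- exact: ker.
- move=> x Zx; apply/idP/idP.
    by move=> /(ssB_succP r0 Zx)/(page_diff_im r0 (ssZS_sub Zx)).
  by move/(page_diff_im r0 (ssZS_sub Zx))/(ssB_succP r0 Zx).
- move=> e; have [x Zx -> kx] := cls_surj e.
  move/(page_diff_ker r0 Zx): kx => /ssBP[a [b [Za Zb dxE]]].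
  have {}Zb : b \in ssZ C r.-1 (q + 1).
    by move: Zb; have -> : q + r%:Z - r.-1%:Z = q + 1 by lia.
  have Bb : b \in ssB C r q := ssB_left Zb.
  exists (x - b).
    apply/andP; split.
      by apply: submodB; [case/andP: Zx | case/andP: (ssB_sub r0 Bb)].
    rewrite linearB /= dxE addrK; case/andP: Za => Fa _.
    by apply: (fil_mono _ Fa); lia.
  have -> : pcls C r q (x - b) = pcls C r q x.
    apply/(clsP _ (submodB Zx (ssB_sub r0 Bb)) Zx).
    by rewrite addrAC subrr add0r submodN.
  by rewrite /pcls subrr rpred0.
by exists h => // x Zx; split; [exact: ker | exact: hE].
Qed.

Lemma page_diff_spectral : is_spectral_sequence page_diff.
Proof.
split.
- exact: ssB_sub.
- by move=> r p _; apply: page_bigraded.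
- by move=> r p x r0 Zx; rewrite ssZ_diff ?page_diffE.
- move=> r p k e r0 /page_degP[x [Zx Gx ->]]; apply/page_degP.
  by exists (d x); rewrite ssZ_diff ?gr_diff ?page_diffE.
- move=> r p e r0; have [x Zx ->] := cls_surj e.
  rewrite -/(pcls C r p x) page_diffE // page_diffE ?ssZ_diff //.
  by rewrite diff_diff; apply/cls_eq0; exact: rpred0.
- by move=> r p; apply: page_homology.
Qed.

End SpectralSequence.

(** * Leading components *)

Section Leading.
Variables (F : fieldType) (K : lmodType F) (S n : nat).
Variables (C : filtered_graded_complex K S n) (G : splitting C).
Local Notation d := (diff C).

Lemma component_neq i j x : x \in part G j -> i != j -> component G i x = 0.
Proof.
move=> Px ij; have [jN|jN] := boolP (0 <= j <= S%:Z); last first.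
  by rewrite (part_zero jN Px) linear0.
rewrite (@component_uniq _ _ _ _ _ G x (fun l => if l == j then x else 0)).
  by rewrite (negPf ij).
split=> [l|]; first by case: eqP => [->|_] //; exact: rpred0.
case: j jN Px ij => // m; rewrite lez_nat -ltnS => /andP[_ mS] _ _.
by rewrite -big_mkcond (big_pred1 (Ordinal mS)) // => l; rewrite eqz_nat.
Qed.

(** The filtration is recovered from the splitting: K_q is the sum of the K_(j)
    with j >= q. *)
Lemma filP q x : x \in fil C q <-> forall j, j < q -> component G j x = 0.
Proof.
split=> [Fx j jq|x0]; first exact: component_fil _ Fx jq.
rewrite (component_sum G x); apply: rpred_sum => j _.
have [jq|qj] := ltP j%:Z q; first by rewrite x0 ?rpred0.
exact: (fil_mono qj (part_fil (component_part G _ _))).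
Qed.

Lemma fil_addP p r x : x \in fil C p ->
  x \in fil C (p + r%:Z) <-> forall m, (m < r)%N -> component G (p + m%:Z) x = 0.
Proof.
move=> Fx; rewrite filP; split=> [x0 m mr|x0 j jr]; first by apply: x0; lia.
have [jp|pj] := ltP j p; first exact: component_fil _ Fx jp.
have -> : j = p + `|j - p|%N%:Z by lia.
by apply: x0; lia.
Qed.

Lemma component_diff_part q q' x : x \in part G q ->
  component G q' (d x) = if q <= q' then dcomp G `|q' - q|%N x else 0.
Proof.
move=> Px; case: leP => [qq'|q'q].
  by rewrite (dcompE _ Px); congr component; lia.
exact: component_fil (fil_diff (part_fil Px)) q'q.
Qed.

Lemma fil_sub_components p m x : x \in fil C p ->
  x - \sum_(0 <= j < m) component G (p + j%:Z) x \in fil C (p + m%:Z).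
Proof.
move=> Fx; apply/filP => q qm; rewrite linearB linear_sum /=.
have [qp|pq] := ltP q p.
  rewrite (component_fil _ Fx) // big1 ?subr0 // => j _.
  by apply: component_neq (component_part _ _ _) _; lia.
have /andP[q0 qE] : (`|q - p|%N < m)%N && (q == p + `|q - p|%N%:Z) by lia.
rewrite big_mkord (bigD1 (Ordinal q0)) //= -(eqP qE) (component_id (component_part G q x)).
rewrite big1 ?addr0 ?subrr // => j; rewrite -val_eqE /= => jq.
by apply: component_neq (component_part _ _ _) _; lia.
Qed.

(** The next lemmas concern the lift c = x - z_(p+1) - ... - z_(p+r-1) of x: the
    low components of dc are the defects of the cocycle equations, and its
    component in degree p + r is the expression of the differential. *)
Lemma component_diff_corrected r p m x (z : nat -> K) : x \in part G p ->
    (forall j, (1 <= j < r)%N -> z j \in part G (p + j%:Z)) ->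
  component G (p + m%:Z) (d (x - \sum_(1 <= j < r) z j)) =
  dcomp G m x - \sum_(1 <= j < r | (j <= m)%N) dcomp G (m - j) (z j).
Proof.
move=> Px Pz; rewrite !linearB /= -(dcompE _ Px); congr (_ - _).
rewrite !linear_sum [RHS]big_mkcond /=; apply: eq_big_nat => j jr.
rewrite (component_diff_part _ (Pz j jr)) lerD2l lez_nat.
by case: leqP => // jm; congr (dcomp G _ _); lia.
Qed.

Lemma component_diff_corrected_lt r p m x (z : nat -> K) : (m < r)%N ->
    x \in part G p ->
    (forall j, (1 <= j < r)%N -> z j \in part G (p + j%:Z)) ->
  component G (p + m%:Z) (d (x - \sum_(1 <= j < r) z j)) =
  dcomp G m x - \sum_(0 <= i < m) dcomp G i (z (m - i)%N).
Proof.
move=> mr Px Pz; rewrite component_diff_corrected //; congr (_ - _).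
rewrite -(big_nat_widen 1 m.+1 r xpredT) // big_add1 big_nat_rev /=.
by apply: eq_big_nat => i im; congr (dcomp G _ (z _)); lia.
Qed.

Lemma component_diff_corrected_last r p x (z : nat -> K) :
    x \in part G p ->
    (forall j, (1 <= j < r)%N -> z j \in part G (p + j%:Z)) ->
  component G (p + r%:Z) (d (x - \sum_(1 <= j < r) z j)) =
  dcomp G r x - \sum_(1 <= i < r) dcomp G i (z (r - i)%N).
Proof.
move=> Px Pz; rewrite component_diff_corrected //; congr (_ - _).
rewrite big_nat_cond (eq_bigl (fun j => (1 <= j < r)%N && true)); last by move=> j; lia.
rewrite -big_nat_cond big_nat_rev /=.
by apply: eq_big_nat => i im; congr (dcomp G _ (z _)); lia.
Qed.

Lemma corrected_fil r p x (z : nat -> K) : x \in part G p ->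
    (forall j, (1 <= j < r)%N -> z j \in part G (p + j%:Z)) ->
  x - \sum_(1 <= j < r) z j \in fil C p.
Proof.
move=> Px Pz; apply: submodB; first exact: part_fil Px.
rewrite big_nat; apply: rpred_sum => j jr.
by apply: (fil_mono _ (part_fil (Pz j jr))); lia.
Qed.

Lemma component_corrected r p x (z : nat -> K) : x \in part G p ->
    (forall j, (1 <= j < r)%N -> z j \in part G (p + j%:Z)) ->
  component G p (x - \sum_(1 <= j < r) z j) = x.
Proof.
move=> Px Pz; rewrite linearB linear_sum /= component_id // big_nat big1 ?subr0 // => j jr.
by apply: component_neq (Pz j jr) _; lia.
Qed.

Lemma corrected_ssZ r p x (z : nat -> K) : (0 < r)%N -> x \in part G p ->
    (forall j, (1 <= j < r)%N -> z j \in part G (p + j%:Z)) ->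
  x - \sum_(1 <= j < r) z j \in ssZ C r p <->
  dcomp G 0 x = 0 /\ cocycle_data G r p x z.
Proof.
move=> r0 Px Pz; have Fc := corrected_fil Px Pz.
rewrite ssZE Fc /= fil_addP; last exact: fil_diff.
split=> [c0|[x0 [_ zE]] m mr].
  split=> [|].
    by rewrite -(c0 0%N r0) component_diff_corrected_lt // big_geq // subr0.
  split=> // m /andP[_ mr].
  by apply/subr0_eq; rewrite -(component_diff_corrected_lt mr Px Pz) c0.
rewrite component_diff_corrected_lt //.
case: m mr => [|m] mr; first by rewrite big_geq // subr0.
by rewrite zE // subrr.
Qed.

(** From right to left, the correcting terms are the components of -c in degrees
    p + 1, ..., p + r - 1; dropping the later components of c changes dc only
    inside K_(p+r). *)
Lemma ZrP r p x : (0 < r)%N ->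
  x \in Zr G r p <-> exists2 c, c \in ssZ C r p & x = component G p c.
Proof.
move=> r0; split=> [/asboolP[Px x0 [z zP]]|[c Zc ->]].
  exists (x - \sum_(1 <= j < r) z j).
    by apply/corrected_ssZ => //; case: zP.
  by rewrite component_corrected //; case: zP.
pose z j := - component G (p + j%:Z) c.
have Pz j : (1 <= j < r)%N -> z j \in part G (p + j%:Z).
  by move=> _; apply/submodN/component_part.
suff: component G p c - \sum_(1 <= j < r) z j \in ssZ C r p.
  case/corrected_ssZ=> // [|c0 zP]; first exact: component_part.
  by apply/asboolP; split=> //; [exact: component_part | exists z].
have -> : component G p c - \sum_(1 <= j < r) z j =
    \sum_(0 <= j < r) component G (p + j%:Z) c.
  by rewrite [RHS]big_ltn // addr0 /z sumrN opprK.
have [Fc _] := andP Zc; have := fil_sub_components r Fc; set s := \sum_(0 <= j < r) _ => Ft.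
have -> : s = c - (c - s) by rewrite opprB addrC subrK.
apply: submodB Zc _; apply/andP; split; last exact: fil_diff.
by apply: fil_mono Ft; lia.
Qed.

Lemma component_diff_sum r p l (c : nat -> K) : (l < r)%N ->
    (forall k, (k < r)%N -> c k \in part G (p - k%:Z)) ->
  component G (p - l%:Z) (d (\sum_(0 <= k < r) c k)) =
  \sum_(l <= k < r) dcomp G (k - l) (c k).
Proof.
move=> lr Pc; rewrite (big_nat_widenl l 0) // [RHS]big_mkcond !linear_sum /=.
apply: eq_big_nat => k /andP[_ kr].
rewrite (component_diff_part _ (Pc k kr)) lerD2l lerN2 lez_nat.
by case: leqP => // lk; congr (dcomp G _ _); lia.
Qed.

(** The coboundary equations say that b = c_p + ... + c_(p-r+1), which starts in
    degree p - r + 1, has a differential that starts in degree p. *)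
Lemma sum_ssZ r p (c : nat -> K) : (0 < r)%N ->
    (forall k, (k < r)%N -> c k \in part G (p - k%:Z)) ->
  \sum_(0 <= k < r) c k \in ssZ C r.-1 (p - r.-1%:Z) <->
  forall l, (1 <= l < r)%N -> 0 = \sum_(l <= k < r) dcomp G (k - l) (c k).
Proof.
move=> r0 Pc.
have Fb : \sum_(0 <= k < r) c k \in fil C (p - r.-1%:Z).
  rewrite big_nat; apply: rpred_sum => k kr.
  by apply: (fil_mono _ (part_fil (Pc k _))); lia.
rewrite ssZE Fb /= fil_addP; last exact: fil_diff.
split=> [b0 l lr|b0 m mr].
  have /andP[_ lr'] := lr; rewrite -(component_diff_sum lr' Pc).
  have -> : p - l%:Z = p - r.-1%:Z + (r.-1 - l)%N%:Z by lia.
  by rewrite b0 //; lia.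
have -> : p - r.-1%:Z + m%:Z = p - (r.-1 - m)%N%:Z by lia.
by rewrite component_diff_sum -?b0 //; lia.
Qed.

(** As for ZrP, the components of b in degrees above p can be dropped: they only
    affect db inside K_(p+1), so not its component in degree p. *)
Lemma BrP r p x : (0 < r)%N ->
  x \in Br G r p <->
  exists2 b, b \in ssZ C r.-1 (p - r.-1%:Z) & x = component G p (d b).
Proof.
move=> r0; have sum0 (c : nat -> K) : (forall k, (k < r)%N -> c k \in part G (p - k%:Z)) ->
    component G p (d (\sum_(0 <= k < r) c k)) = \sum_(0 <= k < r) dcomp G k (c k).
  move=> Pc; have := component_diff_sum r0 Pc; rewrite subr0 => ->.
  by apply: eq_bigr => k _; rewrite subn0.
split=> [/asboolP[c [Pc -> c0]]|[b Zb ->]].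
  by exists (\sum_(0 <= k < r) c k); [apply/sum_ssZ | rewrite sum0].
pose c k := component G (p - k%:Z) b.
have Pc k : (k < r)%N -> c k \in part G (p - k%:Z) by move=> _; apply: component_part.
pose s := \sum_(0 <= k < r) c k.
have Fbs : b - s \in fil C (p + 1).
  have [Fb _] := andP Zb; have := fil_sub_components r Fb.
  have -> : p - r.-1%:Z + r%:Z = p + 1 by lia.
  rewrite big_nat_rev /= /s.
  suff -> : \sum_(0 <= i < r) component G (p - r.-1%:Z + (0 + r - i.+1)%N%:Z) b =
    \sum_(0 <= k < r) c k by [].
  by apply: eq_big_nat => k kr; congr component; lia.
have sE : s = b - (b - s) by rewrite opprB addrC subrK.
apply/asboolP; exists c; split=> //.
  have : component G p (d (b - s)) = 0.
    by apply: (component_fil _ (fil_diff Fbs)); lia.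
  by rewrite -sum0 // -/s !linearB => /subr0_eq.
suff Zs : s \in ssZ C r.-1 (p - r.-1%:Z) by apply/(sum_ssZ r0 Pc).
rewrite sE; apply: submodB => //.
apply/andP; split; first by apply: (fil_mono _ Fbs); lia.
by apply: (fil_mono _ (fil_diff Fbs)); lia.
Qed.

Lemma fil_succ p x : x \in fil C p -> component G p x = 0 -> x \in fil C (p + 1).
Proof. by move=> Fx x0; apply/(fil_addP 1 Fx); case=> // _; rewrite addr0. Qed.

(** Leading components detect membership in ssB: if x and db have the same one,
    their difference is in K_(p+1), and d(x - db) = dx is in
    K_((p+1)+(r-1)). *)
Lemma component_ssB r p x : (0 < r)%N -> x \in ssZ C r p ->
  (x \in ssB C r p) = (component G p x \in Br G r p).
Proof.
move=> r0 /andP[Fx Fdx]; apply/idP/idP.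
  move=> /ssBP[a [b [/andP[Fa _] Zb ->]]]; apply/BrP => //; exists b => //.
  rewrite linearD /= (component_fil _ Fa) ?add0r //; lia.
move=> /(BrP _ _ r0)[b Zb e]; apply/ssBP; exists (x - d b), b.
split=> //; last by rewrite subrK.
have [_ Fdb] := andP Zb.
apply/andP; split.
  apply: fil_succ; last by rewrite linearB /= e subrr.
  by apply: submodB => //; apply: (fil_mono _ Fdb); lia.
by rewrite linearB /= diff_diff subr0; apply: (fil_mono _ Fdx); lia.
Qed.

Lemma component_hom_part p k x :
  component G p (hom_part C k x) = hom_part C k (component G p x).
Proof.
apply/esym/(hom_part_uniq (v := fun l => component G p (hom_part C l x))) => [l|].
  by case: (cpl_sub (component_cpl G p (hom_part_gr C l x))).
by rewrite -linear_sum -hom_part_sum.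
Qed.

Lemma leading_iso_exists r p : exists phi : {linear page C r p -> ZBquot G r p},
  (0 < r)%N -> bijective phi /\
    {in ssZ C r p, forall x, phi (pcls C r p x) = zbcls G r p (component G p x)}.
Proof.
case: r => [|r]; first by exists (\0).
have [||||h h_bij hE] := @subquot_iso F K K (ssZ C r.+1 p) (ssB C r.+1 p)
  (Zr G r.+1 p) (Br G r.+1 p) (component G p).
- by move=> a x y _ _; rewrite linearP.
- by move=> x Zx; apply/ZrP => //; exists x.
- by move=> x; apply: component_ssB.
- move=> y /ZrP[] // c Zc ->; exists c => //.
  by rewrite subrr rpred0.
by exists h.
Qed.

Definition leading_iso r p := sval (cid (leading_iso_exists r p)).

Lemma leading_iso_bij r p : (0 < r)%N -> bijective (leading_iso r p).
Proof. by case/(svalP (cid (leading_iso_exists r p))). Qed.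

Lemma leading_isoE r p x : (0 < r)%N -> x \in ssZ C r p ->
  leading_iso r p (pcls C r p x) = zbcls G r p (component G p x).
Proof. by case/(svalP (cid (leading_iso_exists r p))) => _; apply. Qed.

(** A homogeneous class of leading components has a homogeneous lift, since
    hom_part can be applied to any lift without changing the leading component. *)
Lemma leading_iso_deg r p k e : (0 < r)%N ->
  (leading_iso r p e \in ZBquot_deg G r p k) = (e \in page_deg C r p k).
Proof.
move=> r0; apply/idP/idP.
  move=> /asboolP[y [/(ZrP _ _ r0)[c Zc ->] Gy phiE]].
  apply/page_degP; exists (hom_part C k c); rewrite ssZ_hom_part ?hom_part_gr //.
  split=> //; apply: (bij_inj (leading_iso_bij p r0)).
  by rewrite phiE leading_isoE ?ssZ_hom_part // component_hom_part hom_part_id.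
move=> /page_degP[x [Zx Gx ->]]; rewrite leading_isoE //; apply/asboolP.
exists (component G p x); split=> //; first by apply/ZrP => //; exists x.
by case: (cpl_sub (component_cpl G p Gx)).
Qed.

Lemma leading_diff_exists r p :
  exists pd : {linear ZBquot G r p -> ZBquot G r (p + r%:Z)}, (0 < r)%N ->
    forall e, leading_iso r (p + r%:Z) (page_diff C r p e) = pd (leading_iso r p e).
Proof.
case: r => [|r]; first by exists (\0).
pose k : {linear page C r.+1 p -> ZBquot G r.+1 (p + r.+1%:Z)} :=
  leading_iso r.+1 (p + r.+1%:Z) \o page_diff C r.+1 p.
have [pd pdE] := linear_factor k (leading_iso_bij p (ltn0Sn r)).
by exists pd => _ e; rewrite -[LHS]/(k e) pdE.
Qed.

Lemma Br_sub r p : (0 < r)%N -> {subset Br G r p <= Zr G r p}.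
Proof.
move=> r0 x /(BrP _ _ r0)[b Zb ->]; apply/ZrP => //; exists (d b) => //.
apply: ssB_sub => //; apply/ssBP; exists 0, b.
by rewrite rpred0 add0r.
Qed.

End Leading.

Theorem corollary4p7 (F : fieldType) (K : lmodType F) (S n : nat)
    (C : filtered_graded_complex K S n) (G : splitting C) :
  exists2 dE : forall (r : nat) (p : int),
      {linear page C r p -> page C r (p + r%:Z)},
    is_spectral_sequence dE &
  exists (phi : forall (r : nat) (p : int), {linear page C r p -> ZBquot G r p})
         (pd : forall (r : nat) (p : int),
            {linear ZBquot G r p -> ZBquot G r (p + r%:Z)}),
  [/\ (forall (r : nat) (p : int), (0 < r)%N ->
         {subset Br G r p <= Zr G r p} /\ bijective (phi r p)),
      (forall (r : nat) (p : int) (x : K), (0 < r)%N -> x \in ssZ C r p ->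
         component G p x \in Zr G r p /\
         phi r p (pcls C r p x) = zbcls G r p (component G p x)),
      (forall (r : nat) (p k : int) (e : page C r p), (0 < r)%N ->
         (phi r p e \in ZBquot_deg G r p k) = (e \in page_deg C r p k)),
      (forall (r : nat) (p : int) (e : page C r p), (0 < r)%N ->
         phi r (p + r%:Z) (dE r p e) = pd r p (phi r p e)) &
      (forall (r : nat) (p : int) (x : K) (z : nat -> K),
         (1 <= r <= S)%N -> x \in Zr G r p ->
         cocycle_data G r p x z ->
         let y := dcomp G r x - \sum_(1 <= i < r) dcomp G i (z (r - i)%N) in
         y \in Zr G r (p + r%:Z) /\
         pd r p (zbcls G r p x) = zbcls G r (p + r%:Z) y)].
Proof.
exists (page_diff C); first exact: page_diff_spectral.
pose pd r p := sval (cid (leading_diff_exists G r p)).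
have pdE r p e : (0 < r)%N ->
    leading_iso G r (p + r%:Z) (page_diff C r p e) = pd r p (leading_iso G r p e).
  by move=> r0; apply: (svalP (cid (leading_diff_exists G r p))).
exists (leading_iso G), pd; split=> //.
- by move=> r p r0; split; [exact: Br_sub | exact: leading_iso_bij].
- move=> r p x r0 Zx; split; last exact: leading_isoE.
  by apply/ZrP => //; exists x.
- by move=> r p k e r0; apply: leading_iso_deg.
(* The differential of [x] is computed on the lift c of x given by z. *)
move=> r p x z /andP[r0 _] /asboolP[Px x0 _] zP y.
have [Pz _] := zP; pose c := x - \sum_(1 <= j < r) z j.
have Zc : c \in ssZ C r p by apply/(corrected_ssZ r0 Px Pz).
have yE : y = component G (p + r%:Z) (diff C c).
  by rewrite component_diff_corrected_last.
split; first by apply/ZrP => //; exists (diff C c); rewrite ?ssZ_diff.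
have -> : zbcls G r p x = leading_iso G r p (pcls C r p c).
  by rewrite leading_isoE // component_corrected.
rewrite -pdE // page_diffE // yE; apply: leading_isoE => //.
exact: ssZ_diff.
Qed.
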